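(* Let $2\le a\le b$ be integers. Then $r(I_p)=a-1$ if $p=(1,b-1)$. Moreover, for $p=(c,d)\in H^+_{a,b}$ with $0<c<a$ and $0<d<b$, one has $r(I_p)=1$ if and only if $a/2\le c$ and $b/2\le d$. In particular, $r(I_p)=1$ for $p=(a-1,b-1)$.
   Context: $K$ is a field. $H^+_{a,b}=\{(c,d)\in\mathbb Z^2 : bc+ad\ge ab\}$. For $p=(c,d)\in H^+_{a,b}$ with $c,d\geq 0$ put $I_p=(x^a,y^b,x^cy^d)\subset K[x,y]$. With $J=(x^a,y^b)$, the reduction number $r(I_p)$ is the smallest integer $r\ge0$ with $I_p^{r+1}=JI_p^r$ (such $r$ exists). *)

(* Defs.v *)
From HB Require Import structures.
From mathcomp Require Import all_boot all_order all_algebra.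
From mathcomp Require Import mpoly.
Set Implicit Arguments.
Unset Strict Implicit.
Unset Printing Implicit Defensive.
Import Order.TTheory GRing.Theory Num.Theory.
Local Open Scope ring_scope.

(* Ideals of R are Prop-valued predicates on R (membership in an ideal of
   K[x, y] is not assumed decidable), compared by extensional equality. *)

Definition ideal_eq (R : comNzRingType) (I J : R -> Prop) : Prop :=
  forall f : R, I f <-> J f.

Definition ideal_gen (R : comNzRingType) (s : seq R) : R -> Prop :=
  fun f => exists c : 'I_(size s) -> R, f = \sum_(i < size s) c i * s`_i.

Definition ideal_mul (R : comNzRingType) (I J : R -> Prop) : R -> Prop :=
  fun f => exists s : seq (R * R),
    (forall u : R * R, u \in s -> I u.1 /\ J u.2) /\
    f = \sum_(u <- s) u.1 * u.2.

Fixpoint ideal_exp (R : comNzRingType) (I : R -> Prop) (n : nat) : R -> Prop :=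
  if n is m.+1 then ideal_mul I (ideal_exp I m) else fun _ => True.

Definition is_reduction_number (R : comNzRingType) (J I : R -> Prop) (r : nat)
    : Prop :=
  ideal_eq (ideal_exp I r.+1) (ideal_mul J (ideal_exp I r)) /\
  (forall s : nat,
     ideal_eq (ideal_exp I s.+1) (ideal_mul J (ideal_exp I s)) -> (r <= s)%N).

Definition varx (K : fieldType) : {mpoly K[2]} := 'X_(0 : 'I_2).
Definition vary (K : fieldType) : {mpoly K[2]} := 'X_(1 : 'I_2).

Definition Hplus (a b : nat) : pred (int * int) :=
  fun p => a%:Z * b%:Z <= b%:Z * p.1 + a%:Z * p.2.

Definition ideal_J (K : fieldType) (a b : nat) : {mpoly K[2]} -> Prop :=
  ideal_gen [:: varx K ^+ a; vary K ^+ b].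

(* I_p is only defined for p with nonnegative coordinates, hence p : nat * nat. *)
Definition ideal_I (K : fieldType) (a b : nat) (p : nat * nat) :
    {mpoly K[2]} -> Prop :=
  ideal_gen [:: varx K ^+ a; vary K ^+ b; varx K ^+ p.1 * vary K ^+ p.2].

Arguments ideal_J : clear implicits.
Arguments ideal_I : clear implicits.

(* Main.v *)
Require Import Defs.
From HB Require Import structures.
From mathcomp Require Import all_boot all_order all_algebra.
From mathcomp Require Import mpoly zify.
Set Implicit Arguments.
Unset Strict Implicit.
Unset Printing Implicit Defensive.
Import Order.TTheory GRing.Theory Num.Theory.
Local Open Scope ring_scope.

(** All the ideals involved are generated by monomials, so a polynomial lies in
    one of them exactly when each monomial of its support is divisible by one
    of the generators (see [ideal_gen_monomials]), and the product of two such
    ideals is the monomial ideal of the sums of exponents (see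
    [ideal_mul_monomial]).  Hence I^n is generated by the x^(ai+ck) y^(bj+dk)
    with i + j + k = n.

    Since I is generated by J and the monomial x^c y^d, the only generator of
    I^(r+1) that is not visibly in J I^r is the power (x^c y^d)^(r+1).  So
    I^(r+1) = J I^r holds if and only if this power is divisible by some
    (x^a)^i (y^b)^j (x^c y^d)^k with i + j + k = r + 1 and i + j > 0, which is
    a condition on natural numbers (see [reduction_criterion]).

    For (c, d) = (1, b-1), divisibility forces i = 0 as long as r + 1 < a, and
    then each factor y^b costs one more y than the x y^(b-1) it replaces, so
    that j = 0 as well, against i + j > 0; whereas (x y^(b-1))^a is divisible
    by x^a (y^b)^(a-1) because a <= b.  For 0 < c < a and 0 < d < b, the
    equality fails at r = 0, and at r = 1 the only candidate that can divide
    x^(2c) y^(2d) is x^a y^b. *)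

(** * Ideals generated by monomials *)

Lemma ideal_mulS (R : comNzRingType) (I I' J J' : R -> Prop) :
  (forall f, I f -> I' f) -> (forall f, J f -> J' f) ->
  forall f, ideal_mul I J f -> ideal_mul I' J' f.
Proof.
move=> sI sJ f [s [Hs ->]]; exists s; split=> // u /Hs [Iu Ju].
by split; [apply: sI | apply: sJ].
Qed.

Lemma eq_ideal_mul (R : comNzRingType) (I I' J J' : R -> Prop) :
  ideal_eq I I' -> ideal_eq J J' -> ideal_eq (ideal_mul I J) (ideal_mul I' J').
Proof.
by move=> eI eJ f; split; apply: ideal_mulS => g; rewrite ?eI ?eJ.
Qed.

Lemma ideal_eq_trans (R : comNzRingType) (I J L : R -> Prop) :
  ideal_eq I J -> ideal_eq J L -> ideal_eq I L.
Proof. by move=> eIJ eJL f; rewrite (eIJ f). Qed.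

Lemma ideal_mul0 (R : comNzRingType) (I J : R -> Prop) : ideal_mul I J 0.
Proof. by exists [::]; rewrite big_nil. Qed.

Lemma ideal_mulD (R : comNzRingType) (I J : R -> Prop) f g :
  ideal_mul I J f -> ideal_mul I J g -> ideal_mul I J (f + g).
Proof.
move=> [s [Hs ->]] [t [Ht ->]]; exists (s ++ t); rewrite big_cat; split=> // u.
by rewrite mem_cat => /orP[/Hs | /Ht].
Qed.

Lemma ideal_mul_prod (R : comNzRingType) (I J : R -> Prop) f g :
  I f -> J g -> ideal_mul I J (f * g).
Proof.
move=> If Jg; exists [:: (f, g)]; rewrite big_seq1; split=> // u.
by rewrite inE => /eqP->.
Qed.

Lemma ideal_gen0 (R : comNzRingType) (s : seq R) : ideal_gen s 0.
Proof. by exists (fun=> 0); rewrite big1 // => i _; rewrite mul0r. Qed.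

Lemma ideal_genD (R : comNzRingType) (s : seq R) f g :
  ideal_gen s f -> ideal_gen s g -> ideal_gen s (f + g).
Proof.
move=> [u ->] [v ->]; exists (fun i => u i + v i).
by rewrite -big_split; apply: eq_bigr => i _; rewrite mulrDl.
Qed.

Lemma ideal_gen_mem (R : comNzRingType) (s : seq R) f g :
  g \in s -> ideal_gen s (f * g).
Proof.
move=> sg; have ltg : (index g s < size s)%N by rewrite index_mem.
exists (fun i => if i == Ordinal ltg then f else 0).
rewrite (bigD1 (Ordinal ltg)) //= eqxx nth_index // big1 ?addr0 // => i.
by move/negPf=> ->; rewrite mul0r.
Qed.

Definition monomial_ideal (K : fieldType) (n : nat) (E : 'X_{1..n} -> Prop) :
    {mpoly K[n]} -> Prop :=
  fun f => forall m, m \in msupp f -> exists2 e, E e & (e <= m)%MM.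
Arguments monomial_ideal K {n} E.

Lemma monomial_idealX (K : fieldType) n (E : 'X_{1..n} -> Prop) m :
  monomial_ideal K E 'X_[m] <-> exists2 e, E e & (e <= m)%MM.
Proof.
by split=> [|H m']; [apply; rewrite msuppX inE | rewrite msuppX inE => /eqP->].
Qed.

Lemma monomial_idealS (K : fieldType) n (E F : 'X_{1..n} -> Prop) :
  (forall e, E e -> exists2 e', F e' & (e' <= e)%MM) ->
  forall f, monomial_ideal K E f -> monomial_ideal K F f.
Proof.
move=> sEF f Ef m /Ef [e Ee le_em]; have [e' Fe' le_e'e] := sEF e Ee.
by exists e' => //; apply: lepm_trans le_em.
Qed.

Lemma eq_monomial_ideal (K : fieldType) n (E F : 'X_{1..n} -> Prop) :
  (forall e, E e <-> F e) ->
  ideal_eq (monomial_ideal K E) (monomial_ideal K F).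
Proof.
by move=> eEF f; split; apply: monomial_idealS => e /eEF He; exists e;
  rewrite ?lepm_refl.
Qed.

Lemma monomial_ideal_sum (K : fieldType) n (E : 'X_{1..n} -> Prop)
    (T : eqType) (s : seq T) (F : T -> {mpoly K[n]}) :
  (forall x, x \in s -> monomial_ideal K E (F x)) ->
  monomial_ideal K E (\sum_(x <- s) F x).
Proof.
move=> EF; rewrite big_seq; apply: big_ind => //.
  by move=> m; rewrite msupp0.
move=> f g Ef Eg m /msuppD_le; rewrite mem_cat.
by move=> /orP[/Ef | /Eg].
Qed.

(** Every polynomial is the sum of its terms, so an additively closed I has to
    be checked only on the terms divisible by an allowed monomial. *)
Lemma monomial_ideal_sub (K : fieldType) n (E : 'X_{1..n} -> Prop)
    (I : {mpoly K[n]} -> Prop) :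
  I 0 -> (forall f g, I f -> I g -> I (f + g)) ->
  (forall (c : K) (m e : 'X_{1..n}), E e -> I (c *: 'X_[m + e])) ->
  forall f, monomial_ideal K E f -> I f.
Proof.
move=> I0 ID IX f Ef; rewrite [f]mpolyE big_seq; apply: big_ind => // m.
move=> /Ef [e Ee le_em]; rewrite -(submK le_em); exact: IX.
Qed.

Lemma ideal_gen_monomials (K : fieldType) n (es : seq 'X_{1..n}) :
  ideal_eq (ideal_gen [seq 'X_[K, e] | e <- es])
           (monomial_ideal K (fun e => e \in es)).
Proof.
move=> f; split=> [[c ->] |]; last first.
  apply: monomial_ideal_sub => [||c m e es_e].
  - exact: ideal_gen0.
  - by move=> g h; apply: ideal_genD.
  - by rewrite mpolyXD scalerAl; apply/ideal_gen_mem/map_f.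
apply: monomial_ideal_sum => i _ m /msuppM_le /allpairsP [[m1 m2] /= []] _.
have lt_i : (i < size es)%N by rewrite -(size_map (fun e => 'X_[K, e])) ltn_ord.
rewrite (nth_map 0%MM) // msuppX inE => /eqP-> ->.
by exists (nth 0%MM es i); [apply: mem_nth | apply: lem_addl].
Qed.

Lemma lepm_add n (m1 m2 m1' m2' : 'X_{1..n}) :
  (m1 <= m1')%MM -> (m2 <= m2')%MM -> (m1 + m2 <= m1' + m2')%MM.
Proof.
move=> /mnm_lepP le1 /mnm_lepP le2; apply/mnm_lepP => i.
by rewrite !mnmDE leq_add.
Qed.

Lemma ideal_mul_monomial (K : fieldType) n (E F : 'X_{1..n} -> Prop) :
  ideal_eq (ideal_mul (monomial_ideal K E) (monomial_ideal K F))
    (monomial_ideal K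
       (fun m => exists e1 e2, [/\ E e1, F e2 & m = (e1 + e2)%MM])).
Proof.
move=> f; split=> [[s [Hs ->]] |]; last first.
  apply: monomial_ideal_sub => [||c m _ [e1 [e2 [Ee1 Fe2 ->]]]].
  - exact: ideal_mul0.
  - by move=> g h; apply: ideal_mulD.
  rewrite addmA mpolyXD scalerAl; apply: ideal_mul_prod; last first.
    by apply/monomial_idealX; exists e2; rewrite ?lepm_refl.
  move=> m' /msuppZ_le; rewrite msuppX inE => /eqP->.
  by exists e1 => //; apply: lem_addl.
apply: monomial_ideal_sum => u /Hs [Eu Fu] m /msuppM_le.
move=> /allpairsP [[m1 m2] /= [/Eu [e1 Ee1 le1] /Fu [e2 Fe2 le2] ->]].
by exists (e1 + e2)%MM; [exists e1, e2 | apply: lepm_add].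
Qed.

(** * Powers of I and the criterion for a reduction *)

Definition expo (u v : nat) : 'X_{1..2} := (U_(0%R) *+ u + U_(1%R) *+ v)%MM.

Lemma varxy_expo (K : fieldType) u v :
  varx K ^+ u * vary K ^+ v = 'X_[expo u v].
Proof. by rewrite mpolyXD -!mpolyXn. Qed.

Lemma expo_le u v u' v' :
  (expo u v <= expo u' v')%MM = (u <= u')%N && (v <= v')%N.
Proof.
have E0 p q : expo p q 0 = p.
  by rewrite mnmDE !mulmnE !mnm1E /=; lia.
have E1 p q : expo p q 1 = q.
  by rewrite mnmDE !mulmnE !mnm1E /=; lia.
apply/mnm_lepP/andP => [le_uv | [le_u le_v] i].
  by have := (le_uv 0, le_uv 1); rewrite !E0 !E1 => -[].
have [-> | ->] : i = 0 \/ i = 1; last 2 first.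
- by rewrite E0 E0.
- by rewrite E1 E1.
by case: i => [[|[|//]] lt_i]; [left | right]; apply: val_inj.
Qed.

Lemma expoD u v u' v' : (expo u v + expo u' v' = expo (u + u') (v + v'))%MM.
Proof. by apply/mnmP => i; rewrite !mnmDE !mulmnE; lia. Qed.

Lemma ideal_J_monomial (K : fieldType) a b :
  ideal_eq (ideal_J K a b)
    (monomial_ideal K (fun e => e \in [:: expo a 0; expo 0 b])).
Proof.
have := @ideal_gen_monomials K 2 [:: expo a 0; expo 0 b].
by rewrite /= -!varxy_expo !expr0 mulr1 mul1r.
Qed.

Lemma ideal_I_monomial (K : fieldType) a b c d :
  ideal_eq (ideal_I K a b (c, d))
    (monomial_ideal K (fun e => e \in [:: expo a 0; expo 0 b; expo c d])).
Proof.
have := @ideal_gen_monomials K 2 [:: expo a 0; expo 0 b; expo c d].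
by rewrite /= -!varxy_expo !expr0 mulr1 mul1r.
Qed.

Lemma ideal_exp_monomial (K : fieldType) a b c d n :
  ideal_eq (ideal_exp (ideal_I K a b (c, d)) n)
    (monomial_ideal K (fun e => exists i j k,
       (i + j + k)%N = n /\ e = expo (a * i + c * k) (b * j + d * k))).
Proof.
elim: n => [|n IHn].
  move=> f; split=> // _ m _; exists (expo 0 0); last first.
    by apply/mnm_lepP => i; rewrite mnmDE !mulmnE !muln0.
  by exists 0%N, 0%N, 0%N; rewrite !muln0.
apply: ideal_eq_trans (eq_ideal_mul (@ideal_I_monomial K a b c d) IHn) _.
apply: ideal_eq_trans (ideal_mul_monomial _ _) _.
apply: eq_monomial_ideal => e; split.
  move=> [e1 [_ [e1I [i [j [k [ijk ->]]]] ->]]].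
  move: e1I; rewrite !inE => /or3P[] /eqP->; rewrite expoD.
  - by exists i.+1, j, k; split; [lia | congr expo; lia].
  - by exists i, j.+1, k; split; [lia | congr expo; lia].
  - by exists i, j, k.+1; split; [lia | congr expo; lia].
move=> [i [j [k [ijk ->]]]].
case: i => [|i] in ijk *; last first.
  exists (expo a 0), (expo (a * i + c * k) (b * j + d * k)).
  rewrite !inE eqxx expoD; split=> //; last by congr expo; lia.
  by exists i, j, k; split; first lia.
case: j => [|j] in ijk *; last first.
  exists (expo 0 b), (expo (a * 0 + c * k) (b * j + d * k)).
  rewrite !inE eqxx orbT expoD; split=> //; last by congr expo; lia.
  by exists 0%N, j, k; split; first lia.
exists (expo c d), (expo (c * n) (d * n)).
rewrite !inE eqxx !orbT expoD; split=> //; last by congr expo; lia.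
by exists 0%N, 0%N, n; rewrite !muln0.
Qed.

(** Both sides are monomial ideals, so it is enough to compare generators.  A
    generator of I^(r+1) involving x^a or y^b is already one of J I^r, which
    leaves (x^c y^d)^(r+1). *)
Lemma reduction_criterion (K : fieldType) a b c d r :
  let I := ideal_I K a b (c, d) in
  ideal_eq (ideal_exp I r.+1) (ideal_mul (ideal_J K a b) (ideal_exp I r)) <->
  exists i j k, [/\ (i + j + k)%N = r.+1, (0 < i + j)%N,
    (a * i + c * k <= c * r.+1)%N & (b * j + d * k <= d * r.+1)%N].
Proof.
move=> I.
set S := fun e => exists i j k, [/\ (i + j + k)%N = r.+1, (0 < i + j)%N
    & e = expo (a * i + c * k) (b * j + d * k)].
have JI_S : ideal_eq (ideal_mul (ideal_J K a b) (ideal_exp I r))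
                     (monomial_ideal K S).
  apply: ideal_eq_trans (eq_ideal_mul (@ideal_J_monomial K a b)
    (@ideal_exp_monomial K a b c d r)) _.
  apply: ideal_eq_trans (ideal_mul_monomial _ _) _.
  apply: eq_monomial_ideal => e; split.
    move=> [e1 [_ [e1J [i [j [k [ijk ->]]]] ->]]].
    move: e1J; rewrite !inE => /orP[] /eqP->; rewrite expoD.
    - by exists i.+1, j, k; split; [lia | lia | congr expo; lia].
    - by exists i, j.+1, k; split; [lia | lia | congr expo; lia].
  move=> [[|i] [j [k [ijk ij_gt0 ->]]]].
    case: j => [|j] // in ijk ij_gt0 *.
    exists (expo 0 b), (expo 0 (b * j) + expo (c * k) (d * k))%MM.
    rewrite !inE eqxx orbT !expoD; split=> //; last by congr expo; lia.
    by exists 0%N, j, k; split; [lia | congr expo; lia].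
  exists (expo a 0), (expo (a * i) (b * j) + expo (c * k) (d * k))%MM.
  rewrite !inE eqxx !expoD; split=> //; last by congr expo; lia.
  by exists i, j, k; split; [lia | congr expo; lia].
split=> [eqI | [i [j [k [ijk ij_gt0 le_x le_y]]]] f].
  have /JI_S/monomial_idealX : ideal_mul (ideal_J K a b) (ideal_exp I r)
      'X_[expo (c * r.+1) (d * r.+1)].
    apply/eqI/ideal_exp_monomial/monomial_idealX.
    exists (expo (c * r.+1) (d * r.+1)); last exact: lepm_refl.
    by exists 0%N, 0%N, r.+1; rewrite !muln0.
  move=> [_ [i [j [k [ijk ij_gt0 ->]]]]]; rewrite expo_le => /andP[le_x le_y].
  by exists i, j, k.
split=> [/ideal_exp_monomial If | /JI_S JIf]; last first.
  apply/ideal_exp_monomial; apply: monomial_idealS JIf => e.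
  move=> [i' [j' [k' [ijk' _ ->]]]]; eexists; last exact: lepm_refl.
  by exists i', j', k'.
apply/JI_S; apply: monomial_idealS If => _ [i' [j' [k' [ijk' ->]]]].
have [ij'_gt0 | ] := ltnP 0 (i' + j').
  by eexists; last exact: lepm_refl; exists i', j', k'.
rewrite leqn0 addn_eq0 => /andP[/eqP i'0 /eqP j'0].
rewrite i'0 j'0 !add0n in ijk' *; rewrite ijk' !muln0 !add0n.
exists (expo (a * i + c * k) (b * j + d * k)); last by rewrite expo_le le_x.
by exists i, j, k.
Qed.

(** * The reduction numbers *)

(** A factor x^a is too large to divide (x y^(b-1))^(s+1) when s + 1 < a, and
    replacing a factor x y^(b-1) by y^b strictly increases the power of y. *)
Lemma reduction_number_corner (K : fieldType) a b :
  (2 <= a)%N -> (a <= b)%N ->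
  is_reduction_number (ideal_J K a b) (ideal_I K a b (1%N, b.-1)) a.-1.
Proof.
move=> a_ge2 le_ab; split.
  (* (x y^(b-1))^a = x^a (y^b)^(a-1) y^(b-a) *)
  by apply/reduction_criterion; exists 1%N, a.-1, 0%N; split; nia.
move=> s /reduction_criterion [i [j [k [ijk ij_gt0 le_x le_y]]]].
rewrite leqNgt; apply/negP => lt_s.
have i0 : i = 0%N by nia.
subst i; nia.
Qed.

Lemma reduction_number1 (K : fieldType) a b c d :
  (0 < c < a)%N -> (0 < d < b)%N ->
  is_reduction_number (ideal_J K a b) (ideal_I K a b (c, d)) 1 <->
  (a <= c * 2)%N /\ (b <= d * 2)%N.
Proof.
move=> /andP[c_gt0 lt_ca] /andP[d_gt0 lt_db]; split=> [[]|[le_a le_b]].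
  move=> /reduction_criterion [i [j [k [ijk ij_gt0 le_x le_y]]]] _.
  (* x^(2a) and x^(a+c) do not divide x^(2c), and likewise in y, so i = j = 1 *)
  have lt_i2 : (i < 2)%N by nia.
  have lt_j2 : (j < 2)%N by nia.
  by case: i j ijk ij_gt0 lt_i2 lt_j2 le_x le_y => [|[|//]] [|[|//]]; nia.
split.
  by apply/reduction_criterion; exists 1%N, 1%N, 0%N; split; lia.
move=> [|//] /reduction_criterion [i [j [k [ijk ij_gt0 le_x le_y]]]].
(* x^c y^d itself is divisible by neither x^a nor y^b *)
have i0 : i = 0%N by nia.
have j0 : j = 0%N by nia.
by rewrite i0 j0 in ij_gt0.
Qed.

Lemma half_le_natr (m n : nat) :
  (m%:R / 2%:R <= n%:R :> rat) = (m <= n * 2)%N.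
Proof. by rewrite ler_pdivrMr ?ltr0n // -natrM ler_nat. Qed.

Theorem corollary4p3 (K : fieldType) (a b : nat)
    (ha : (2 <= a)%N) (hab : (a <= b)%N) :
  [/\ is_reduction_number (ideal_J K a b) (ideal_I K a b (1%N, b.-1)) a.-1,
      forall c d : nat,
        Hplus a b (c%:Z, d%:Z) -> (0 < c < a)%N -> (0 < d < b)%N ->
        (is_reduction_number (ideal_J K a b) (ideal_I K a b (c, d)) 1 <->
         (a%:R / 2%:R <= c%:R :> rat) /\ (b%:R / 2%:R <= d%:R :> rat))
    & is_reduction_number (ideal_J K a b) (ideal_I K a b (a.-1, b.-1)) 1].
Proof.
split; first exact: reduction_number_corner.
- by move=> c d _ c_bounds d_bounds; rewrite !half_le_natr reduction_number1.
- by apply/reduction_number1; lia.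
Qed.
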